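(* Let $\mathcal V$ be a variety. Each of the following identities, holding in $\mathcal V$ (i.e. in every algebra of $\mathcal V$, for all relations of the kind specified below), is equivalent to congruence distributivity of $\mathcal V$; and each identity holds in $\mathcal V$ if and only if it holds in $\mathbf F_{\mathcal V}(3)$. (Inside each item, the listed forms are equivalent.) (1) $\Theta(\sigma\circ\sigma)\subseteq(\Theta\sigma)^{\circledast}$; equivalently, $(\Theta(\sigma\circ\sigma))^{\circledast}=(\Theta\sigma)^{\circledast}$. (1$'$) $\Theta(\sigma\circ\sigma)\subseteq(\Theta\sigma\circ\Theta\sigma^{\smile})^{\circledast}$. (1$''$) $\Theta(\sigma\circ\sigma^{\smile})\subseteq(\Theta\sigma\circ\Theta\sigma^{\smile})^{\circledast}$; equivalently, $(\Theta(\sigma\circ\sigma^{\smile}))^{\circledast}=(\Theta\sigma\circ\Theta\sigma^{\smile})^{\circledast}$. (2) $\Theta\sigma^{\circledast}\subseteq(\Theta\sigma)^{\circledast}$; equivalently, $(\Theta\sigma^{\circledast})^{\circledast}=(\Theta\sigma)^{\circledast}$. (3) $\Theta(\sigma\circ\tau)\subseteq(\Theta\sigma\circ\Theta\tau)^{\circledast}$; equivalently, $(\Theta(\sigma\circ\tau))^{\circledast}=(\Theta\sigma\circ\Theta\tau)^{\circledast}$. (4) $\Theta(\sigma\circ\tau)^{\circledast}\subseteq(\Theta\sigma\circ\Theta\tau)^{\circledast}$; equivalently, $(\Theta(\sigma\circ\tau)^{\circledast})^{\circledast}=(\Theta\sigma\circ\Theta\tau)^{\circledast}$. (4$'$) $\Theta(\sigma\circ\tau)^{\circledast}\subseteq(\Theta\sigma\circ\Theta\tau\circ\Theta\sigma^{\smile}\circ\Theta\tau^{\smile})^{\circledast}$;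 equivalently, $(\Theta(\sigma\circ\tau\circ\sigma^{\smile}\circ\tau^{\smile})^{\circledast})^{\circledast}=(\Theta\sigma\circ\Theta\tau\circ\Theta\sigma^{\smile}\circ\Theta\tau^{\smile})^{\circledast}$. In these identities, $\Theta$ ranges over tolerances or, equivalently, over congruences; and $\sigma$ and $\tau$ range over U-admissible relations or, equivalently, over relations expressible as the union of two congruences.
   Context: Juxtaposition denotes intersection and binds more tightly than $\circ$; exponents ($^{\circledast}$, $^{\smile}$) bind more tightly than everything else, so e.g. $\Theta\sigma^{\circledast}=\Theta\cap(\sigma^{\circledast})$, $\Theta(\sigma\circ\tau)^{\circledast}=\Theta\cap((\sigma\circ\tau)^{\circledast})$, and $\Theta\sigma\circ\Theta\tau=(\Theta\cap\sigma)\circ(\Theta\cap\tau)$. $\circ$ is relational composition, $R^{\circledast}$ is the transitive closure of $R$, and $R^{\smile}$ is the converse of $R$. A binary relation on an algebra $\mathbf A$ is admissible if it is compatible with all operations. A tolerance is a reflexive, symmetric and admissible relation. A relation is U-admissible if it is the set-theoretical union of some nonempty set of reflexive and admissible relations on $\mathbf A$. $\mathbf F_{\mathcal V}(3)$ is the free algebra in $\mathcal V$ generated by 3 elements. A variety is congruence distributive if all its algebras have distributive congruence lattices. Inclusions are also called identities, since $A\subseteq B$ is equivalent to $A=A\cap B$. *)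

(* Defs.v *)
From mathcomp Require Import all_boot.
From Stdlib Require Import Relations List.
From Stdlib Require Import ClassicalEpsilon FunctionalExtensionality.
From Stdlib Require Import PropExtensionality ProofIrrelevance.
Set Implicit Arguments.
Unset Strict Implicit.
Unset Printing Implicit Defensive.

(** * Relations *)

Section Relations.
Variable A : Type.
Implicit Types R S : relation A.

Definition capr R S : relation A := fun a b => R a b /\ S a b.
Definition compr R S : relation A := fun a c => exists b, R a b /\ S b c.
Definition tclos R : relation A := clos_trans A R.
Definition conv R : relation A := transp A R.
Definition subr R S : Prop := inclusion A R S.
Definition eqr R S : Prop := same_relation A R S.

End Relations.

Declare Scope relalg_scope.
Delimit Scope relalg_scope with RA.
Bind Scope relalg_scope with relation.
Notation "R ⊛" := (tclos R) (at level 2, left associativity, format "R ⊛")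
  : relalg_scope.
Notation "R ˘" := (conv R) (at level 2, left associativity, format "R ˘")
  : relalg_scope.
Notation "R ∩ S" := (capr R S) (at level 40, left associativity) : relalg_scope.
Notation "R ∘ S" := (compr R S) (at level 45, left associativity) : relalg_scope.
Notation "R ⊆ S" := (subr R S) (at level 70, no associativity) : relalg_scope.
Notation "R ≡ S" := (eqr R S) (at level 70, no associativity) : relalg_scope.

(** * Algebras, terms, varieties *)

Record signature := Signature { op : Type; arity : op -> nat }.

Record algebra (S : signature) := Algebra {
  carrier :> Type;
  interp : forall o : op S, ('I_(arity o) -> carrier) -> carrier;
  carrier_nonempty : inhabited carrier
}.

Inductive term (S : signature) (X : Type) : Type :=
| Var (x : X)
| App (o : op S) (ts : 'I_(arity o) -> term S X).
Arguments Var {S X} x.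
Arguments App {S X} o ts.

Fixpoint eval (S : signature) (A : algebra S) (X : Type) (v : X -> A)
    (t : term S X) : A :=
  match t with
  | Var x => v x
  | App o ts => interp (fun i => eval v (ts i))
  end.

Definition satisfies (S : signature) (A : algebra S) (s t : term S nat) : Prop :=
  forall v : nat -> A, eval v s = eval v t.

Definition is_variety (S : signature) (V : algebra S -> Prop) : Prop :=
  exists E : term S nat -> term S nat -> Prop,
    forall A : algebra S, V A <-> forall s t, E s t -> satisfies A s t.

Definition is_hom (S : signature) (A B : algebra S) (h : A -> B) : Prop :=
  forall (o : op S) (a : 'I_(arity o) -> A),
    h (interp a) = interp (fun i => h (a i)).

(** [F] is the free algebra in [V] over the family of generators [x].  The
    generators are not required to be distinct: they collapse exactly when [V]
    contains only one-element algebras. *)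
Definition is_free (S : signature) (V : algebra S -> Prop) (X : Type)
    (F : algebra S) (x : X -> F) : Prop :=
  V F /\
  forall B : algebra S, V B -> forall y : X -> B,
    exists h : F -> B,
      is_hom h /\ (forall i, h (x i) = y i) /\
      forall h' : F -> B,
        is_hom h' -> (forall i, h' (x i) = y i) -> forall a, h' a = h a.

(** * Relations on algebras *)

Section AlgebraRelations.
Variables (S : signature) (A : algebra S).
Implicit Types R sigma : relation A.
Local Open Scope relalg_scope.

Definition admissible R : Prop :=
  forall (o : op S) (a b : 'I_(arity o) -> A),
    (forall i, R (a i) (b i)) -> R (interp a) (interp b).

Definition is_tolerance R : Prop :=
  Relation_Definitions.reflexive A R /\ Relation_Definitions.symmetric A R /\
  admissible R.

Definition is_congruence R : Prop := equivalence A R /\ admissible R.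

Definition U_admissible sigma : Prop :=
  exists P : relation A -> Prop,
    (exists R, P R) /\
    (forall R, P R -> Relation_Definitions.reflexive A R /\ admissible R) /\
    (forall a b, sigma a b <-> exists R, P R /\ R a b).

Definition union_of_two_congruences sigma : Prop :=
  exists alpha beta : relation A,
    is_congruence alpha /\ is_congruence beta /\
    sigma ≡ Relation_Operators.union A alpha beta.

(** The join in the congruence lattice: the least congruence above both. *)
Definition cong_join (alpha beta : relation A) : relation A :=
  fun a b => forall gamma : relation A,
    is_congruence gamma -> alpha ⊆ gamma -> beta ⊆ gamma -> gamma a b.

Definition distributive_congruence_lattice : Prop :=
  forall alpha beta gamma : relation A,
    is_congruence alpha -> is_congruence beta -> is_congruence gamma ->
    alpha ∩ cong_join beta gamma
      ≡ cong_join (alpha ∩ beta) (alpha ∩ gamma).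

End AlgebraRelations.

Definition congruence_distributive (S : signature) (V : algebra S -> Prop)
    : Prop :=
  forall A : algebra S, V A -> distributive_congruence_lattice A.

(** * Relation identities *)

(** An identity in the variables [Θ], [σ], [τ]; the last one may not occur. *)
Definition rel_identity : Type :=
  forall A : Type, relation A -> relation A -> relation A -> Prop.

Inductive item := I1 | I1' | I1'' | I2 | I3 | I4 | I4'.

Definition forms (i : item) : list rel_identity :=
  (match i with
  | I1 =>
    [:: fun A Θ σ τ => Θ ∩ (σ ∘ σ) ⊆ (Θ ∩ σ)⊛;
        fun A Θ σ τ => (Θ ∩ (σ ∘ σ))⊛ ≡ (Θ ∩ σ)⊛]
  | I1' =>
    [:: fun A Θ σ τ => Θ ∩ (σ ∘ σ) ⊆ ((Θ ∩ σ) ∘ (Θ ∩ σ˘))⊛]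
  | I1'' =>
    [:: fun A Θ σ τ => Θ ∩ (σ ∘ σ˘) ⊆ ((Θ ∩ σ) ∘ (Θ ∩ σ˘))⊛;
        fun A Θ σ τ => (Θ ∩ (σ ∘ σ˘))⊛ ≡ ((Θ ∩ σ) ∘ (Θ ∩ σ˘))⊛]
  | I2 =>
    [:: fun A Θ σ τ => Θ ∩ σ⊛ ⊆ (Θ ∩ σ)⊛;
        fun A Θ σ τ => (Θ ∩ σ⊛)⊛ ≡ (Θ ∩ σ)⊛]
  | I3 =>
    [:: fun A Θ σ τ => Θ ∩ (σ ∘ τ) ⊆ ((Θ ∩ σ) ∘ (Θ ∩ τ))⊛;
        fun A Θ σ τ => (Θ ∩ (σ ∘ τ))⊛ ≡ ((Θ ∩ σ) ∘ (Θ ∩ τ))⊛]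
  | I4 =>
    [:: fun A Θ σ τ => Θ ∩ (σ ∘ τ)⊛ ⊆ ((Θ ∩ σ) ∘ (Θ ∩ τ))⊛;
        fun A Θ σ τ => (Θ ∩ (σ ∘ τ)⊛)⊛ ≡ ((Θ ∩ σ) ∘ (Θ ∩ τ))⊛]
  | I4' =>
    [:: fun A Θ σ τ =>
          Θ ∩ (σ ∘ τ)⊛
            ⊆ ((Θ ∩ σ) ∘ (Θ ∩ τ) ∘ (Θ ∩ σ˘) ∘ (Θ ∩ τ˘))⊛;
        fun A Θ σ τ =>
          (Θ ∩ (σ ∘ τ ∘ σ˘ ∘ τ˘)⊛)⊛
            ≡ ((Θ ∩ σ) ∘ (Θ ∩ τ) ∘ (Θ ∩ σ˘) ∘ (Θ ∩ τ˘))⊛]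
  end)%RA.

Inductive Theta_range := Tolerances | Congruences.
Inductive sigma_range := U_admissibles | Unions_of_two_congruences.

Definition in_Theta_range (k : Theta_range) (S : signature) (A : algebra S)
    : relation A -> Prop :=
  match k with
  | Tolerances => @is_tolerance S A
  | Congruences => @is_congruence S A
  end.

Definition in_sigma_range (l : sigma_range) (S : signature) (A : algebra S)
    : relation A -> Prop :=
  match l with
  | U_admissibles => @U_admissible S A
  | Unions_of_two_congruences => @union_of_two_congruences S A
  end.

Definition holds_in (k : Theta_range) (l : sigma_range) (p : rel_identity)
    (S : signature) (A : algebra S) : Prop :=
  forall Θ σ τ : relation A,
    in_Theta_range k Θ -> in_sigma_range l σ -> in_sigma_range l τ ->
    p A Θ σ τ.

Definition holds_throughout (k : Theta_range) (l : sigma_range)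
    (p : rel_identity) (S : signature) (V : algebra S -> Prop) : Prop :=
  forall A : algebra S, V A -> holds_in k l p A.

(** * Existence of free algebras *)

Section FreeAlgebra.
Variables (S : signature) (V : algebra S -> Prop) (n : nat).
Let T := term S 'I_n.+1.

Definition teq (t u : T) : Prop :=
  forall B : algebra S, V B -> forall v : 'I_n.+1 -> B, eval v t = eval v u.

Definition tclass : Type := {C : T -> Prop | exists t, C = teq t}.

Definition cls (t : T) : tclass :=
  exist _ (teq t) (ex_intro _ t (erefl (teq t))).

Definition repr (c : tclass) : T :=
  proj1_sig (constructive_indefinite_description _ (proj2_sig c)).

Lemma cls_eq t u : teq t u -> cls t = cls u.
Proof.
move=> tu; apply: eq_sig_hprop => /=; first by move=> *; apply: proof_irrelevance.
apply: functional_extensionality => w; apply: propositional_extensionality.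
by split=> h B VB v; rewrite -(h B VB v) (tu B VB v).
Qed.

Lemma reprK c : cls (repr c) = c.
Proof.
apply: eq_sig_hprop => /=; first by move=> *; apply: proof_irrelevance.
by rewrite /repr; case: constructive_indefinite_description.
Qed.

Lemma repr_cls t : teq (repr (cls t)) t.
Proof.
have := f_equal (@proj1_sig _ _) (reprK (cls t)) => /= ->.
by move=> B VB v.
Qed.

Definition free_algebra : algebra S :=
  @Algebra S tclass (fun o cs => cls (App o (fun i => repr (cs i))))
    (inhabits (cls (Var ord0))).

Definition free_gen (i : 'I_n.+1) : free_algebra := cls (Var i).

Fixpoint tsubst X (r : X -> T) (t : term S X) : T :=
  match t with
  | Var x => r x
  | App o ts => App o (fun i => tsubst r (ts i))
  end.

Lemma eval_tsubst X (r : X -> T) (B : algebra S) (v : 'I_n.+1 -> B) t :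
  eval v (tsubst r t) = eval (fun x => eval v (r x)) t.
Proof.
elim: t => [//|o ts IH] /=; congr interp.
by apply: functional_extensionality => i.
Qed.

Lemma eval_free X (w : X -> free_algebra) t :
  eval w t = cls (tsubst (fun x => repr (w x)) t).
Proof.
elim: t => [x|o ts IH] /=; first by rewrite reprK.
apply: cls_eq => B VB v /=; congr interp.
by apply: functional_extensionality => i; rewrite IH (repr_cls _ VB).
Qed.

Lemma free_algebraP : is_variety V -> is_free V free_gen.
Proof.
move=> [E VE]; split.
  apply/VE => s t st w; rewrite !eval_free; apply: cls_eq => B VB v.
  by rewrite !eval_tsubst; apply: (proj1 (VE B) VB).
move=> B VB y; exists (fun c => eval y (repr c)); split=> [o cs|].
  by rewrite (repr_cls _ VB).
split=> [i|h' hom_h' h'y c]; first by rewrite (repr_cls _ VB).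
rewrite -{1}(reprK c); elim: (repr c) => [i|o ts IH]; first exact: h'y.
have -> : cls (App o ts) = interp (fun i => cls (ts i) : free_algebra).
  apply: cls_eq => C VC v /=; congr interp.
  by apply: functional_extensionality => i; rewrite (repr_cls _ VC).
rewrite hom_h' /=; congr interp.
by apply: functional_extensionality => i.
Qed.

End FreeAlgebra.

(* Main.v *)
Require Import Defs.
From mathcomp Require Import all_boot.
From Stdlib Require Import Relations List.
From Stdlib Require Import FunctionalExtensionality PropExtensionality.
Set Implicit Arguments.
Unset Strict Implicit.
Unset Printing Implicit Defensive.

(** All seven identities follow from the single inclusion
    Θ ∩ σ⊛ ⊆ (Θ ∩ σ)⊛ for tolerances Θ and U-admissible σ, because
    σ ∪ τ and σ ∪ σ˘ are again U-admissible ([head_form_intro]).  Conversely,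
    when σ is a union of two congruences, hence symmetric, each of them
    specializes at τ := σ to Θ ∩ (σ ∘ σ) ⊆ (Θ ∩ σ)⊛ ([head_form_elim]).

    In the free algebra on x, y, z, let Θ, β, γ be the kernels of the
    identifications x = z, x = y, y = z, and take σ := β ∪ γ.  Then (x, z)
    lies in Θ ∩ (σ ∘ σ), and a path from x to z in Θ ∩ σ is read off as a
    sequence of Jónsson terms t_0, ..., t_n ([jonsson_terms_of_chain]).
    Congruence distributivity of the free algebra gives the same path.

    It remains to obtain the strong inclusion from Jónsson terms
    ([jonsson_cap_tclos]).  Let a Θ c with a σ⊛ c, and write Q for (Θ ∩ σ)⊛.
    Moving the middle argument of t_k(a, -, c) along the σ-path from a to c
    gives t_k(a,a,c) Q t_k(a,c,c).  The usual Jónsson argument then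
    runs through the even terms backwards, which is harmless for symmetric σ
    only; what is needed for a directed path is that Jónsson terms can be
    replaced by directed ones, a theorem of Kazda, Kozik, McKenzie and Moore.
    The argument given here uses only a weak trace of the Jónsson equations:

      t_k(a,a,c) Q t_(k+1)(a,c,c)  for all k,  t_0 = x,  t_n = z.

    Such a sequence, called a fence, can be shortened by one term: with
    e_0 = x and e_(k+1)(x,y,z) = t_(k+1)(e_k(x,y,z), y, z), the operations
    s_k = t_k(e_k, e_k, e_(k+1)) for k < n - 1, followed by z, are again
    a fence ([fence_shorten]).  A fence with no intermediate term says that
    a Q c. *)

(** * Shortening fences *)

Section Fences.
Variables (A : Type) (B : A -> Prop) (le Q : relation A).

(** For a term operation t with t(x,y,x) = x these are the properties that the
    argument uses when Q is (Θ ∩ σ)⊛, [le] is σ⊛ and B is a set of pairwise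
    Θ-related elements: the outer arguments stay in B, while the middle one
    moves freely along [le]. *)
Record jonsson_op (f : A -> A -> A -> A) : Prop := JonssonOp {
  jop_le : forall u u' v v' w w',
    le u u' -> le v v' -> le w w' -> le (f u v w) (f u' v' w');
  jop_Q : forall u u' v v' w w',
    Q u u' -> Q v v' -> Q w w' -> Q (f u v w) (f u' v' w');
  jop_id : forall u v, f u v u = u;
  jop_B : forall u v w, B u -> B w -> B (f u v w);
  jop_mid : forall u v v' w, B u -> B w -> le v v' -> Q (f u v w) (f u v' w)
}.

(** Jónsson terms form a fence whichever of the two equations, on (a,a,c) or
    on (a,c,c), links b_k to b_(k+1): the other half of the step is the
    movement of the middle argument. *)
Definition fence (m : nat) (b : nat -> A -> A -> A -> A) : Prop :=
  [/\ forall k, k <= m.+1 -> jonsson_op (b k),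
      forall u v w, b 0 u v w = u,
      forall u v w, b m.+1 u v w = w &
      forall k, k <= m -> forall a c, B a -> B c -> le a c ->
        Q (b k a a c) (b k.+1 a c c)].

Hypothesis le_refl : Relation_Definitions.reflexive A le.
Hypothesis le_trans : Relation_Definitions.transitive A le.
Hypothesis Q_refl : Relation_Definitions.reflexive A Q.
Hypothesis Q_trans : Relation_Definitions.transitive A Q.

Lemma jonsson_op_left : jonsson_op (fun u _ _ => u).
Proof. by split. Qed.

Lemma jonsson_op_right : jonsson_op (fun _ _ w => w).
Proof. by split. Qed.

(** The inner operations turn a [le]-move of the middle argument into Q-moves,
    which f preserves.  The bare middle projection does not do so; its use
    as an inner operation is the case of [jonsson_op_comp_mid]. *)
Lemma jonsson_op_comp f g1 g2 g3 :
    jonsson_op f -> jonsson_op g1 -> jonsson_op g2 -> jonsson_op g3 ->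
  jonsson_op (fun u v w => f (g1 u v w) (g2 u v w) (g3 u v w)).
Proof.
move=> Jf J1 J2 J3; split=> *.
- by apply: (jop_le Jf); [apply: (jop_le J1)|apply: (jop_le J2)|apply: (jop_le J3)].
- by apply: (jop_Q Jf); [apply: (jop_Q J1)|apply: (jop_Q J2)|apply: (jop_Q J3)].
- by rewrite (jop_id J1) (jop_id J3) (jop_id Jf).
- by apply: (jop_B Jf); [apply: (jop_B J1)|apply: (jop_B J3)].
- by apply: (jop_Q Jf);
    [apply: (jop_mid J1)|apply: (jop_mid J2)|apply: (jop_mid J3)].
Qed.

Lemma jonsson_op_comp_mid f g :
    jonsson_op f -> jonsson_op g -> jonsson_op (fun u v w => f (g u v w) v w).
Proof.
move=> Jf Jg; split=> [*|*|*|*|u v v' w Bu Bw vv'].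
- by apply: (jop_le Jf) => //; apply: (jop_le Jg).
- by apply: (jop_Q Jf) => //; apply: (jop_Q Jg).
- by rewrite (jop_id Jg) (jop_id Jf).
- by apply: (jop_B Jf) => //; apply: (jop_B Jg).
- apply: (Q_trans (y := f (g u v' w) v w)).
    by apply: (jop_Q Jf) => //; apply: (jop_mid Jg).
  by apply: (jop_mid Jf) => //; apply: (jop_B Jg).
Qed.

(** The operations e_k that compose the initial part of the fence along its
    first argument. *)
Fixpoint accum (b : nat -> A -> A -> A -> A) (k : nat) : A -> A -> A -> A :=
  if k is k'.+1 then fun u v w => b k (accum b k' u v w) v w
  else fun u _ _ => u.

Lemma jonsson_op_accum b m :
    (forall k, k <= m -> jonsson_op (b k)) ->
  forall k, k <= m -> jonsson_op (accum b k).
Proof.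
move=> Jb; elim=> [|k IH] km /=; first exact: jonsson_op_left.
by apply: jonsson_op_comp_mid; [apply: Jb|apply: IH; apply: ltnW].
Qed.

(** Write G_k = e_k(a,a,c) and P_k = e_k(a,c,c).  The fence itself gives
    G_k Q P_(k+1) by induction, and monotonicity gives
    a le G_k le G_(k+1) le c and G_k le P_k.  The fence condition for the
    operations b_k(e_k, e_k, e_(k+1)) is the path

      b_k(G_k, G_k, G_(k+1)) Q b_(k+1)(G_k, G_(k+1), G_(k+1))
                             Q b_(k+1)(G_k, G_(k+1), P_(k+2))
                             Q b_(k+1)(G_k, P_(k+1), P_(k+2))
                             Q b_(k+1)(P_(k+1), P_(k+1), P_(k+2)),

    whose first step is the old fence at the pair (G_k, G_(k+1)).  When
    k + 1 is the last intermediate index, one more step of the old fence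
    leads from the end of this path to c; this is why an operation is saved. *)
Lemma fence_shorten m b : fence m.+1 b -> exists b', fence m b'.
Proof.
case=> Jb b_first b_last b_step.
have JE := jonsson_op_accum Jb.
pose E := accum b.
pose s k u v w := b k (E k u v w) (E k u v w) (E k.+1 u v w).
have Js k : k <= m.+1 -> jonsson_op (s k).
  move=> km; apply: (jonsson_op_comp (Jb k _) (JE k _) (JE k _) (JE k.+1 _));
    by rewrite // ltnW.
exists (fun k => if k <= m then s k else fun _ _ w => w); split.
- move=> k km; case: ifP => [k_le_m|_]; last exact: jonsson_op_right.
  by apply: Js; apply: leqW.
- by move=> u v w; rewrite /= /s /= b_first.
- by move=> u v w; rewrite ltnn.
move=> k km a c Ba Bc ac; rewrite km.
pose G k := E k a a c; pose P k := E k a c c.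
have BG j : j <= m.+2 -> B (G j) by move=> jm; apply: (jop_B (JE j jm)).
have BP j : j <= m.+2 -> B (P j) by move=> jm; apply: (jop_B (JE j jm)).
have le_c j y : j <= m.+2 -> le y c -> le (E j a y c) c.
  move=> jm yc; rewrite -[X in le _ X](jop_id (JE j jm) c c).
  exact: (jop_le (JE j jm)).
have GG j : j < m.+2 -> le (G j) (G j.+1).
  move=> jm; rewrite -[X in le X _](jop_id (Jb j.+1 jm) (G j) a).
  apply: (jop_le (Jb j.+1 jm)) => //; apply: le_c => //; exact: ltnW.
have aG j : j <= m.+2 -> le a (G j).
  elim: j => [|j IH] jm; first exact: le_refl.
  by apply: (le_trans (IH (ltnW jm))); apply: GG.
have GP j : j < m.+2 -> Q (G j) (P j.+1).
  elim: j => [|j IH] jm; first by rewrite -[X in Q X _](b_first a a c); apply: b_step.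
  have jm' := ltnW jm; have jm'' := ltnW jm'.
  apply: (Q_trans (y := b j.+1 (G j) (G j) c)).
    by apply: (jop_mid (Jb _ jm')) => //; [apply: BG|apply: aG].
  apply: (Q_trans (y := b j.+2 (G j) c c)).
    by apply: b_step => //; [apply: BG|apply: le_c].
  by apply: (jop_Q (Jb _ jm)) => //; apply: IH.
have GleP j : j <= m.+2 -> le (G j) (P j).
  by move=> jm; apply: (jop_le (JE j jm)).
have k2 : k.+1 < m.+2 by [].
have k1 := ltnW k2; have k0 := ltnW k1.
have step : Q (s k a a c) (s k.+1 a c c).
  apply: (Q_trans (y := b k.+1 (G k) (G k.+1) (G k.+1))).
    by apply: b_step; [exact: leqW|exact: (BG k)|exact: (BG k.+1)|exact: (GG k)].
  apply: (Q_trans (y := b k.+1 (G k) (G k.+1) (P k.+2))).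
    by apply: (jop_Q (Jb _ k1)) => //; apply: GP.
  apply: (Q_trans (y := b k.+1 (G k) (P k.+1) (P k.+2))).
    by apply: (jop_mid (Jb _ k1)); [apply: BG|apply: BP|apply: GleP].
  by apply: (jop_Q (Jb _ k1)) => //; apply: GP.
case: ifP => // /negbT; rewrite -ltnNge => mk.
have km1 : k = m by apply/eqP; rewrite eqn_leq km.
subst k; apply: (Q_trans step).
(* The old fence at the pair (P_(m+1), c) leads from the end of the path to c. *)
have -> : s m.+1 a c c = b m.+1 (P m.+1) (P m.+1) c.
  by congr (b m.+1 _ _ _); apply: b_last.
rewrite -[X in Q _ X](b_last (P m.+1) c c).
by apply: b_step => //; [apply: BP|apply: le_c].
Qed.

Lemma fence_Q m b : fence m b ->
  forall a c, B a -> B c -> le a c -> Q a c.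
Proof.
elim: m b => [|m IH] b fb; last by have [b' /IH] := fence_shorten fb.
move=> a c Ba Bc ac; have [_ b0 b1 step] := fb.
by rewrite -[X in Q X _](b0 a a c) -[X in Q _ X](b1 a c c); apply: step.
Qed.

End Fences.

(** * Relations, transitive closure and admissibility *)

Local Open Scope relalg_scope.
Notation "R ∪ S" := (Relation_Operators.union _ R S)
  (at level 42, left associativity) : relalg_scope.

Section RelationAlgebra.
Variable A : Type.
Implicit Types R S T : relation A.

Lemma subr_tclos R : R ⊆ R⊛.
Proof. by move=> a b; apply: t_step. Qed.

Lemma tclos_least R S : R ⊆ S⊛ -> R⊛ ⊆ S⊛.
Proof.
move=> RS a b; elim=> [u v /RS //|u v w _ uv _ vw]; exact: t_trans uv vw.
Qed.

Lemma tclos_refl R :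
  Relation_Definitions.reflexive A R -> Relation_Definitions.reflexive A R⊛.
Proof. by move=> Rr a; apply: t_step. Qed.

Lemma tclos_trans R : Relation_Definitions.transitive A R⊛.
Proof. by move=> a b c ab bc; apply: t_trans ab bc. Qed.

Lemma tclos_sym R :
  Relation_Definitions.symmetric A R -> Relation_Definitions.symmetric A R⊛.
Proof.
move=> Rs a b; elim=> [u v /Rs|u v w _ vu _ wv]; first exact: t_step.
exact: t_trans wv vu.
Qed.

Lemma tclos_seq R a b : R⊛ a b ->
  exists n (u : nat -> A), [/\ u 0 = a, u n = b & forall k, k < n -> R (u k) (u k.+1)].
Proof.
move=> Rab; elim: (clos_trans_t1n _ _ _ _ Rab) => [v w vw|v w z vw _ [n [u [u0 un ustep]]]].
  by exists 1, (fun k => if k is 0 then v else w); split=> // -[].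
exists n.+1, (fun k => if k is k'.+1 then u k' else v); split=> // -[_|k] /=.
  by rewrite u0.
exact: ustep.
Qed.

Lemma subr_comprl R S : Relation_Definitions.reflexive A S -> R ⊆ R ∘ S.
Proof. by move=> Sr a b ab; exists b. Qed.

Lemma subr_comprr R S : Relation_Definitions.reflexive A R -> S ⊆ R ∘ S.
Proof. by move=> Rr a b ab; exists a. Qed.

Lemma compr_tclos R S T : R ⊆ T⊛ -> S ⊆ T⊛ -> R ∘ S ⊆ T⊛.
Proof. by move=> RT ST a c [b [/RT ab /ST bc]]; apply: t_trans ab bc. Qed.

Lemma subr_trans R S T : R ⊆ S -> S ⊆ T -> R ⊆ T.
Proof. by move=> RS ST a b /RS /ST. Qed.

End RelationAlgebra.

Section Admissible.
Variables (S : signature) (A : algebra S).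
Implicit Types R Θ σ τ α β γ : relation A.

Lemma eval_admissible X R (v w : X -> A) t :
  admissible R -> (forall x, R (v x) (w x)) -> R (eval v t) (eval w t).
Proof. by move=> Ra vw; elim: t => [x|o ts IH] /=; [apply: vw|apply: Ra]. Qed.

Lemma U_admissible_refl σ : U_admissible σ -> Relation_Definitions.reflexive A σ.
Proof.
by case=> P [[R PR] [Padm Pσ]] a; apply/Pσ; exists R; split=> //; case: (Padm R PR).
Qed.

Lemma U_admissible_union σ τ : U_admissible σ -> U_admissible τ -> U_admissible (σ ∪ τ).
Proof.
move=> [P [[R PR] [Padm Pσ]]] [P' [_ [P'adm P'τ]]].
exists (fun R => P R \/ P' R); split; first by exists R; left.
split=> [R' [/Padm|/P'adm] //|a b]; split.
  by case=> [/Pσ|/P'τ] [R' [PR' ab]]; exists R'; split=> //; [left|right].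
by case=> R' [[PR'|PR'] ab]; [left; apply/Pσ|right; apply/P'τ]; exists R'.
Qed.

Lemma U_admissible_conv σ : U_admissible σ -> U_admissible σ˘.
Proof.
move=> [P [[R PR] [Padm Pσ]]]; exists (fun R => P R˘); split; first by exists R˘.
split=> [R' /Padm [Rr Ra]|a b].
  by split=> // o u v uv; apply: Ra.
split; first by case/Pσ => R' [PR' ba]; exists R'˘.
by case=> R' [PR' ab]; apply/Pσ; exists R'˘.
Qed.

Lemma U_admissible_cap Θ σ : is_tolerance Θ -> U_admissible σ -> U_admissible (Θ ∩ σ).
Proof.
move=> [Θr [_ Θa]] [P [[R PR] [Padm Pσ]]].
exists (fun R' => exists2 R, P R & R' = Θ ∩ R); split; first by exists (Θ ∩ R), R.
split=> [_ [R' /Padm [R'r R'a] ->]|a b].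
  split=> [a|o u v uv]; first by split.
  by split; [apply: Θa|apply: R'a] => i; case: (uv i).
split; first by case=> ab /Pσ [R' [PR' R'ab]]; exists (Θ ∩ R'); split=> //; exists R'.
by case=> _ [[R' PR' ->] [ab R'ab]]; split=> //; apply/Pσ; exists R'.
Qed.

Lemma congruence_admissible R :
  is_congruence R -> Relation_Definitions.reflexive A R /\ admissible R.
Proof. by case=> -[]. Qed.

Lemma congruence_tolerance R : is_congruence R -> is_tolerance R.
Proof. by case=> -[Rr _ Rs] Ra; split. Qed.

Lemma union_congruences_U_admissible σ :
  union_of_two_congruences σ -> U_admissible σ.
Proof.
move=> [α [β [/congruence_admissible aα [/congruence_admissible aβ [σαβ αβσ]]]]].
exists (fun R => R = α \/ R = β); split; first by exists α; left.
split=> [R [] -> //|a b]; split.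
  by case/σαβ => ab; [exists α|exists β]; split=> //; [left|right].
by case=> R [[] -> ab]; apply: αβσ; [left|right].
Qed.

Lemma two_congruences β γ :
  is_congruence β -> is_congruence γ -> union_of_two_congruences (β ∪ γ).
Proof. by move=> Cβ Cγ; exists β, γ; split=> //; split=> //; split. Qed.

(** A σ-step lies in some reflexive admissible R below σ, so it can be carried
    through an operation with the other arguments held fixed.  Thus σ⊛ is
    preserved in each argument separately; transitivity allows the
    arguments to be changed one at a time, and there are finitely many. *)
Lemma U_admissible_tclos σ : U_admissible σ -> admissible σ⊛.
Proof.
move=> Uσ o a b ab; have σr := tclos_refl (U_admissible_refl Uσ).
(* [mix k] agrees with [b] on the first [k] arguments and with [a] on the rest. *)
pose mix k : 'I_(arity o) -> A := fun i => if i < k then b i else a i.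
have mixP k : k <= arity o -> σ⊛ (interp a) (interp (mix k)).
  elim: k => [_|k IH km]; first exact: σr.
  apply: t_trans (IH (ltnW km)) _.
  pose j := Ordinal km; pose upd c i := if i == j then c else mix k i.
  have -> : mix k = upd (a j).
    apply: functional_extensionality => i; rewrite /upd /mix.
    by case: eqP => [-> /=|//]; rewrite ltnn.
  have -> : mix k.+1 = upd (b j).
    apply: functional_extensionality => i; rewrite /upd /mix ltnS leq_eqVlt -val_eqE /=.
    by case: eqP => [ik|//]; congr b; apply: val_inj.
  elim: (ab j) => [u v uv|u v w _ uv _ vw]; last exact: t_trans uv vw.
  apply: t_step; case: Uσ => P [_ [Padm Pσ]].
  have [R [PR Ruv]] := proj1 (Pσ _ _) uv; have [Rr Ra] := Padm R PR.
  by apply/Pσ; exists R; split=> //; apply: Ra => i; rewrite /upd; case: ifP.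
have := mixP _ (leqnn _); congr (σ⊛ _ (interp _)).
by apply: functional_extensionality => i; rewrite /mix ltn_ord.
Qed.

Lemma tclos_union_congruence β γ :
  is_congruence β -> is_congruence γ -> is_congruence (β ∪ γ)⊛.
Proof.
move=> Cβ Cγ; have U := union_congruences_U_admissible (two_congruences Cβ Cγ).
have [[_ _ βs] _] := Cβ; have [[_ _ γs] _] := Cγ.
split; first split.
- exact: (tclos_refl (U_admissible_refl U)).
- exact: tclos_trans.
- by apply: tclos_sym => u v [uv|uv]; [left; apply: βs|right; apply: γs].
- exact: U_admissible_tclos.
Qed.

Lemma cong_join_tclos β γ :
  is_congruence β -> is_congruence γ -> cong_join β γ ≡ (β ∪ γ)⊛.
Proof.
move=> Cβ Cγ; split=> a b.
  move=> ab; apply: (ab _ (tclos_union_congruence Cβ Cγ)) => u v uv;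
    apply: t_step; by [left|right].
move=> ab δ [[_ δt _] _] βδ γδ; elim: ab => [u v [/βδ|/γδ] //|u v w _ uv _ vw].
exact: δt uv vw.
Qed.

Lemma congruence_cap α β :
  is_congruence α -> is_congruence β -> is_congruence (α ∩ β).
Proof.
move=> [[αr αt αs] αa] [[βr βt βs] βa]; split; first split.
- by split.
- by move=> u v w [uv uv'] [vw vw']; split; [apply: αt uv vw|apply: βt uv' vw'].
- by move=> u v [/αs ? /βs ?]; split.
- by move=> o u v uv; split; [apply: αa|apply: βa] => i; case: (uv i).
Qed.

End Admissible.

Lemma eval_hom (S : signature) (A B : algebra S) (h : A -> B) X (v : X -> A) t :
  is_hom h -> h (eval v t) = eval (fun i => h (v i)) t.
Proof.
move=> hh; elim: t => [//|o ts IH] /=; rewrite hh; congr interp.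
exact: functional_extensionality.
Qed.

Lemma kernel_congruence (S : signature) (A B : algebra S) (h : A -> B) :
  is_hom h -> is_congruence (fun u v => h u = h v).
Proof.
move=> hh; split; first by split=> [u|u v w -> ->|u v ->].
move=> o u v uv; rewrite !hh; congr interp; exact: functional_extensionality.
Qed.

(** * Jónsson terms *)

Definition triple (T : Type) (a b c : T) (i : 'I_3) : T :=
  match val i with 0 => a | 1 => b | _ => c end.

Definition ev3 (S : signature) (A : algebra S) (t : term S 'I_3) (a b c : A) : A :=
  eval (triple a b c) t.

Definition jonsson_terms (S : signature) (V : algebra S -> Prop) : Prop :=
  exists n (t : nat -> term S 'I_3), forall A : algebra S, V A ->
    [/\ forall a b c, ev3 (t 0) a b c = a :> A,
        forall a b c, ev3 (t n) a b c = c :> A,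
        forall k, k <= n -> forall a b, ev3 (t k) a b a = a :> A &
        forall k, k < n ->
          (forall a c, ev3 (t k) a a c = ev3 (t k.+1) a a c :> A) \/
          (forall a c, ev3 (t k) a c c = ev3 (t k.+1) a c c :> A)].

Lemma triple_app T T' (f : T -> T') a b c :
  (fun i => f (triple a b c i)) = triple (f a) (f b) (f c).
Proof.
by apply: functional_extensionality => -[[|[|[|]]] ?]; rewrite /triple.
Qed.

Lemma ev3_admissible (S : signature) (A : algebra S) (R : relation A) t u u' v v' w w' :
  admissible R -> R u u' -> R v v' -> R w w' -> R (ev3 t u v w) (ev3 t u' v' w').
Proof.
move=> Ra uu' vv' ww'; apply: eval_admissible => // i.
by rewrite /triple; case: (val i) => [|[|]].
Qed.

Section FromJonssonTerms.
Variables (S : signature) (A : algebra S).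

(** The set of pairwise Θ-related elements in which the argument takes place.
    A tolerance has no blocks in the sense of equivalence relations, so the
    set is generated from a and c. *)
Inductive hull (a c : A) : A -> Prop :=
| hull_l : hull a c a
| hull_r : hull a c c
| hull_op t u v w of (forall a b, ev3 t a b a = a :> A) & hull a c u & hull a c w :
    hull a c (ev3 t u v w).

(** If r is Θ-related to u and to w, then r = t(r,v,r) is Θ-related to
    t(u,v,w); hence the elements related to a given r are closed under the
    generation of the hull. *)
Lemma hull_tolerance (Θ : relation A) a c :
  is_tolerance Θ -> Θ a c -> forall u w, hull a c u -> hull a c w -> Θ u w.
Proof.
case=> Θr [Θs Θa] ac.
have op r t u v w : (forall a b, ev3 t a b a = a :> A) -> Θ r u -> Θ r w ->
    Θ r (ev3 t u v w).
  by move=> tid ru rw; rewrite -[X in Θ X _](tid r v); apply: ev3_admissible.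
have aH u : hull a c u -> Θ a u.
  by elim=> // t r v w tid _ ru _ rw; apply: op.
have cH u : hull a c u -> Θ c u.
  by elim=> [||t r v w tid _ ru _ rw] //; [apply: Θs|apply: op].
move=> u w Hu Hw; elim: Hu; [exact: aH|exact: cH|].
by move=> t r v s tid _ rw _ sw; apply: (Θs); apply: (op) => //; exact: Θs.
Qed.

(** The main inclusion: [fence_Q] with Q := (Θ ∩ σ)⊛, [le] := σ⊛ and
    B := [hull a c]. *)
Lemma jonsson_cap_tclos (V : algebra S -> Prop) (Θ σ : relation A) :
    jonsson_terms V -> V A -> is_tolerance Θ -> U_admissible σ ->
  Θ ∩ σ⊛ ⊆ (Θ ∩ σ)⊛.
Proof.
move=> [n [t tP]] VA tolΘ Uσ a c [ac σac].
have [t0 tn tid tstep] := tP A VA => {tP}.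
have UΘσ := U_admissible_cap tolΘ Uσ.
have Qr := tclos_refl (U_admissible_refl UΘσ).
have Qt := @tclos_trans _ (Θ ∩ σ).
have ler := tclos_refl (U_admissible_refl Uσ).
have let_ := @tclos_trans _ σ.
case: n => [|n] in tn tid tstep *.
  by rewrite -[X in (_)⊛ X _](t0 a a c) tn; apply: Qr.
have Jt k : k <= n.+1 -> jonsson_op (hull a c) σ⊛ (Θ ∩ σ)⊛ (ev3 (A := A) (t k)).
  move=> kn; split.
  - by move=> *; apply: ev3_admissible => //; apply: U_admissible_tclos.
  - by move=> *; apply: ev3_admissible => //; apply: U_admissible_tclos.
  - exact: tid.
  - by move=> u v w Hu Hw; apply: hull_op => //; apply: tid.
  - move=> u v v' w Hu Hw vv'.
    elim: vv' => [r s rs|r s q _ rs _ sq]; last exact: t_trans rs sq.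
    apply: t_step; split.
      by apply: hull_tolerance ac _ _ _ _ => //; apply: hull_op => //; apply: tid.
    case: Uσ => P [_ [Padm Pσ]]; have [R [PR Rrs]] := proj1 (Pσ _ _) rs.
    have [Rr Ra] := Padm R PR.
    by apply/Pσ; exists R; split=> //; apply: ev3_admissible.
have := @fence_Q A (hull a c) σ⊛ (Θ ∩ σ)⊛ ler let_ Qr Qt n
  (fun k => ev3 (A := A) (t k)).
apply=> //; [split=> //|exact: hull_l|exact: hull_r].
move=> k kn u w Hu Hw uw.
case: (tstep k kn) => tE; last rewrite -tE.
  by rewrite tE; apply: (jop_mid (Jt k.+1 kn)).
by apply: (jop_mid (Jt k (leqW kn))).
Qed.

End FromJonssonTerms.

(** The inclusion Θ ∩ σ⊛ ⊆ (Θ ∩ σ)⊛ for a union σ of two congruences is the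
    distributive law, since σ⊛ is then their join. *)
Lemma jonsson_distributive (S : signature) (V : algebra S -> Prop) :
  jonsson_terms V -> congruence_distributive V.
Proof.
move=> J A VA α β γ Cα Cβ Cγ.
have Cαβ := congruence_cap Cα Cβ; have Cαγ := congruence_cap Cα Cγ.
have [joinβγ _] := cong_join_tclos Cβ Cγ.
have [_ joinα] := cong_join_tclos Cαβ Cαγ.
split=> a b.
  move=> [ab /joinβγ βγab]; apply: joinα.
  have U := union_congruences_U_admissible (two_congruences Cβ Cγ).
  have : (α ∩ (β ∪ γ))⊛ a b.
    by apply: (jonsson_cap_tclos J VA (congruence_tolerance Cα) U).
  apply: tclos_least => u v [uv [uv'|uv']]; apply: t_step; by [left|right].
move=> abj; split; first by apply: abj => // u v [].
move=> δ Cδ βδ γδ; apply: abj => // u v [_]; by [apply: βδ|apply: γδ].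
Qed.

(** * The free algebra *)

Section Free.
Variables (S : signature) (V : algebra S -> Prop) (V_variety : is_variety V).
Variables (F : algebra S) (x : 'I_3 -> F) (F_free : is_free V x).

(** The algebra of terms modulo the identities of [V] is also free, and there
    every element is visibly a term; uniqueness in the universal property of
    [F] carries this over to [F]. *)
Lemma free_generated : exists rep : F -> term S 'I_3, forall u, eval x (rep u) = u.
Proof.
have [VF univ] := F_free.
have [VT _] := @free_algebraP S V 2 V_variety.
have [h [hh [hx _]]] := univ _ VT (@free_gen S V 2).
have kh : is_hom (fun c : free_algebra V 2 => eval x (Defs.repr c)).
  by move=> o cs; rewrite (repr_cls _ VF).
exists (fun u => Defs.repr (h u)) => u.
have [e [_ [_ e_uniq]]] := univ _ VF x.
rewrite (e_uniq (fun u => eval x (Defs.repr (h u)))); last first.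
- by move=> i; rewrite hx (repr_cls _ VF).
- by move=> o us /=; rewrite hh kh.
by rewrite -(e_uniq id).
Qed.

Lemma free_identity n (y : 'I_n -> 'I_3) (s t : term S 'I_n) :
    eval (fun i => x (y i)) s = eval (fun i => x (y i)) t ->
  forall A, V A -> forall v : 'I_3 -> A,
    eval (fun i => v (y i)) s = eval (fun i => v (y i)) t.
Proof.
move=> st A VA v; have [_ univ] := F_free; have [h [hh [hx _]]] := univ A VA v.
have E r : eval (fun i => v (y i)) r = h (eval (fun i => x (y i)) r).
  rewrite eval_hom //; congr eval.
  by apply: functional_extensionality => i; rewrite hx.
by rewrite !E st.
Qed.

Let x0 : F := x (inord 0).
Let x1 : F := x (inord 1).
Let x2 : F := x (inord 2).

(** The situation in which (x0, x2) lies in Θ ∩ (σ ∘ σ) for σ = β ∪ γ, and also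
    in the meet of Θ with the join of β and γ. *)
Definition generator_triangle (Θ β γ : relation F) : Prop :=
  [/\ is_congruence Θ, is_congruence β, is_congruence γ,
      Θ x0 x2 & β x0 x1 /\ γ x1 x2].

(** The path is taken for the kernels of the substitutions x = z, x = y, y = z.
    Its elements are terms t_k; being Θ-related to x means t_k(x,y,x) = x,
    and being β- or γ-related to the next one means agreeing with it on
    (x,x,z) or on (x,z,z). *)
Lemma jonsson_terms_of_chain :
    (forall Θ β γ : relation F, generator_triangle Θ β γ -> (Θ ∩ (β ∪ γ))⊛ x0 x2) ->
  jonsson_terms V.
Proof.
move=> chain; have [VF univ] := F_free.
have ex_sub (y : 'I_3 -> 'I_3) : exists h : F -> F,
    is_hom h /\ forall i, h (x i) = x (y i).
  by have [h [hh [hx _]]] := univ F VF (fun i => x (y i)); exists h.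
pose i0 : 'I_3 := inord 0; pose i1 : 'I_3 := inord 1; pose i2 : 'I_3 := inord 2.
have tri0 T (a b c : T) : triple a b c i0 = a by rewrite /triple /= inordK.
have tri1 T (a b c : T) : triple a b c i1 = b by rewrite /triple /= inordK.
have tri2 T (a b c : T) : triple a b c i2 = c by rewrite /triple /= inordK.
have [f [fh fx]] := ex_sub (triple i0 i1 i0).
have [g [gh gx]] := ex_sub (triple i0 i0 i2).
have [e [eh ex_]] := ex_sub (triple i0 i2 i2).
have : ((fun u v => f u = f v) ∩ ((fun u v => g u = g v) ∪ (fun u v => e u = e v)))⊛
    x0 x2.
  apply: chain; split; try exact: kernel_congruence.
    by rewrite !fx tri0 tri2.
  by rewrite !gx !ex_ !(tri0, tri1, tri2).
move=> path; have [n [u [u0 un ustep]]] := tclos_seq path.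
have [rep repK] := free_generated.
have subE (h : F -> F) y r : is_hom h -> (forall i, h (x i) = x (y i)) ->
    h r = eval (fun i => x (y i)) (rep r).
  move=> hh hx; rewrite -{1}(repK r) eval_hom //; congr eval.
  exact: functional_extensionality.
have evE (A : algebra S) t (v : 'I_3 -> A) a b c :
    ev3 t (v a) (v b) (v c) = eval (fun i => v (triple a b c i)) t.
  by rewrite triple_app.
have transfer r r' y0 y1 y2 (A : algebra S) : V A ->
    eval (fun i => x (triple y0 y1 y2 i)) (rep r)
      = eval (fun i => x (triple y0 y1 y2 i)) (rep r') ->
  forall v : 'I_3 -> A,
    ev3 (rep r) (v y0) (v y1) (v y2) = ev3 (rep r') (v y0) (v y1) (v y2).
  by move=> VA rr' v; rewrite !evE; apply: free_identity.
have gen j (A : algebra S) : V A -> forall v : 'I_3 -> A, eval v (rep (x j)) = v j.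
  move=> VA v; apply: (@free_identity 3 id _ (Var j)) => //; exact: repK.
have uf k : k <= n -> f (u k) = x i0.
  elim: k => [_|k IH kn]; first by rewrite u0 fx tri0.
  by rewrite -(IH (ltnW kn)); case: (ustep k kn).
exists n, (fun k => rep (u k)) => A VA; split.
- by move=> a b c; rewrite u0 /ev3 gen ?tri0.
- by move=> a b c; rewrite un /ev3 gen ?tri2.
- move=> k kn a b.
  have E : f (u k) = f (x i0) by rewrite uf // fx tri0.
  rewrite !(subE f _ _ fh fx) in E.
  have := transfer _ _ _ _ _ A VA E (triple a b a); rewrite tri0 tri1 => ->.
  by rewrite /ev3 gen ?tri0.
move=> k kn; have [_ [E|E]] := ustep k kn; [left|right] => a c.
  rewrite !(subE g _ _ gh gx) in E.
  by have := transfer _ _ _ _ _ A VA E (triple a a c); rewrite tri0 tri2.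
rewrite !(subE e _ _ eh ex_) in E.
by have := transfer _ _ _ _ _ A VA E (triple a a c); rewrite tri0 tri2.
Qed.

Lemma distributive_jonsson : distributive_congruence_lattice F -> jonsson_terms V.
Proof.
move=> D; apply: jonsson_terms_of_chain => Θ β γ [CΘ Cβ Cγ Θ02 [β01 γ12]].
have [sub _] := D Θ β γ CΘ Cβ Cγ.
have [joinT _] := cong_join_tclos (congruence_cap CΘ Cβ) (congruence_cap CΘ Cγ).
have : (Θ ∩ β ∪ Θ ∩ γ)⊛ x0 x2.
  apply: joinT; apply: sub; split=> // δ [[_ δt _] _] βδ γδ.
  by apply: (δt _ x1); [apply: βδ|apply: γδ].
by apply: tclos_least => u v [] [uv uv']; apply: t_step; split=> //; [left|right].
Qed.

End Free.

(** * The identities *)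

Section Items.
Variables (S : signature) (A : algebra S) (k : Theta_range) (l : sigma_range).
Implicit Types (Θ σ τ : relation A).

Lemma in_Theta_tolerance Θ : in_Theta_range k Θ -> is_tolerance Θ.
Proof. by case: k => //; apply: congruence_tolerance. Qed.

Lemma in_sigma_U_admissible σ : in_sigma_range l σ -> U_admissible σ.
Proof. by case: l => //; apply: union_congruences_U_admissible. Qed.

Lemma in_sigma_union_conv σ : in_sigma_range l σ -> in_sigma_range l (σ ∪ σ˘).
Proof.
case: l => /= [Uσ|[α [β [Cα [Cβ [σ_sub sub_σ]]]]]].
  exact: U_admissible_union Uσ (U_admissible_conv Uσ).
have [[_ _ αs] _] := Cα; have [[_ _ βs] _] := Cβ.
have sub u v : σ v u -> σ u v.
  by move=> /σ_sub [vu|vu]; apply: sub_σ; [left; apply: αs|right; apply: βs].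
exists α, β; split=> //; split=> //; split=> u v.
  by case=> [|/sub]; apply: σ_sub.
by move=> /sub_σ uv; left.
Qed.

Lemma holds_in_iff (p q : rel_identity) :
    (forall Θ σ τ, is_tolerance Θ -> U_admissible σ -> U_admissible τ ->
      p A Θ σ τ <-> q A Θ σ τ) ->
  holds_in k l p A <-> holds_in k l q A.
Proof.
move=> pq; split=> H Θ σ τ kΘ lσ lτ; apply/pq; try exact: H;
  by [apply: in_Theta_tolerance|apply: in_sigma_U_admissible].
Qed.

End Items.

Section Inclusions.
Variable A : Type.
Implicit Types R S X Y Θ σ τ : relation A.

Lemma tclos_eqr R S : S ⊆ R⊛ -> (R ⊆ S⊛ <-> R⊛ ≡ S⊛).
Proof.
move=> SR; split=> [RS|[RS _]]; last exact: subr_trans (@subr_tclos _ R) RS.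
by split; apply: tclos_least.
Qed.

Lemma cap_mono Θ R S : R ⊆ S -> Θ ∩ R ⊆ Θ ∩ S.
Proof. by move=> RS a b [ab /RS]. Qed.

Lemma cap_unionl Θ σ τ X :
  Θ ∩ σ ⊆ X -> Θ ∩ τ ⊆ X -> Θ ∩ (σ ∪ τ) ⊆ X.
Proof. by move=> σX τX a b [ab [?|?]]; [apply: σX|apply: τX]. Qed.

Lemma cap_refl Θ σ : Relation_Definitions.reflexive A Θ ->
  Relation_Definitions.reflexive A σ -> Relation_Definitions.reflexive A (Θ ∩ σ).
Proof. by split. Qed.

Lemma compr_refl R S : Relation_Definitions.reflexive A R ->
  Relation_Definitions.reflexive A S -> Relation_Definitions.reflexive A (R ∘ S).
Proof. by move=> Rr Sr a; exists a. Qed.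

Lemma subr_compr4 (R1 R2 R3 R4 : relation A) :
    Relation_Definitions.reflexive A R1 -> Relation_Definitions.reflexive A R2 ->
    Relation_Definitions.reflexive A R3 -> Relation_Definitions.reflexive A R4 ->
  let W := R1 ∘ R2 ∘ R3 ∘ R4 in [/\ R1 ⊆ W⊛, R2 ⊆ W⊛, R3 ⊆ W⊛ & R4 ⊆ W⊛].
Proof.
move=> r1 r2 r3 r4 W; have r12 := compr_refl r1 r2; have r123 := compr_refl r12 r3.
split; apply: subr_trans (@subr_tclos _ _).
- apply: subr_trans (subr_comprl r4); apply: subr_trans (subr_comprl r3).
  exact: subr_comprl.
- apply: subr_trans (subr_comprl r4); apply: subr_trans (subr_comprl r3).
  exact: subr_comprr.
- apply: subr_trans (subr_comprl r4); exact: subr_comprr.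
- exact: subr_comprr.
Qed.

Lemma conv_sym σ : Relation_Definitions.symmetric A σ -> σ˘ = σ.
Proof.
move=> σs; apply: functional_extensionality => a.
by apply: functional_extensionality => b; apply: propositional_extensionality; split=> /σs.
Qed.

End Inclusions.

(** The inclusion listed for the item; the equality, when there is one, comes
    after it. *)
Definition head_form (i : item) : rel_identity :=
  List.hd (fun _ _ _ _ => True) (forms i).

Section HeadForms.
Variables (S : signature) (A : algebra S).
Implicit Types Θ σ τ : relation A.

(** In all items but [I4'] the right-hand side of the equality is trivially
    below the left-hand side, for each Θ, σ, τ separately.  In [I4'] the
    equality at σ, τ is derived from the inclusion at σ ∪ σ˘, τ ∪ τ˘, which
    stay in the range of σ and τ. *)
Lemma forms_head i p k l : List.In p (forms i) ->
  holds_in k l p A <-> holds_in k l (head_form i) A.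
Proof.
have two_forms (P Q : rel_identity) : In p [:: P; Q] ->
    (holds_in k l Q A <-> holds_in k l P A) ->
    holds_in k l p A <-> holds_in k l P A.
  by move=> [<-|[<-|[]]].
have two_pointwise (P Q : rel_identity) : In p [:: P; Q] ->
    (forall Θ σ τ, is_tolerance Θ -> U_admissible σ -> U_admissible τ ->
       P A Θ σ τ <-> Q A Θ σ τ) ->
    holds_in k l p A <-> holds_in k l P A.
  move=> pPQ PQ; apply: (two_forms _ _ pPQ); apply: holds_in_iff => *; symmetry; exact: PQ.
case: i; rewrite /head_form /=.
- move/two_pointwise; apply=> Θ σ τ [Θr _] /U_admissible_refl σr _; apply: tclos_eqr.
  exact: subr_trans (cap_mono (subr_comprl σr)) (@subr_tclos _ _).
- by move=> [<-|[]].
- move/two_pointwise; apply=> Θ σ τ [Θr _] /U_admissible_refl σr _; apply: tclos_eqr.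
  apply: compr_tclos; apply: subr_trans (@subr_tclos _ _); apply: cap_mono.
    exact: subr_comprl.
  exact: subr_comprr.
- move/two_pointwise; apply=> Θ σ τ _ _ _; apply: tclos_eqr.
  exact: subr_trans (cap_mono (@subr_tclos _ σ)) (@subr_tclos _ _).
- move/two_pointwise; apply=> Θ σ τ [Θr _] /U_admissible_refl σr /U_admissible_refl τr.
  apply: tclos_eqr.
  apply: compr_tclos; apply: subr_trans (@subr_tclos _ _); apply: cap_mono.
    exact: subr_comprl.
  exact: subr_comprr.
- move/two_pointwise; apply=> Θ σ τ [Θr _] /U_admissible_refl σr /U_admissible_refl τr.
  apply: tclos_eqr.
  apply: compr_tclos; apply: subr_trans (@subr_tclos _ _); apply: cap_mono;
    apply: subr_trans (@subr_tclos _ _); [exact: subr_comprl|exact: subr_comprr].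
move/two_forms; apply; split=> H Θ σ τ kΘ lσ lτ;
  have [Θr [Θs _]] := in_Theta_tolerance kΘ;
  have σr := U_admissible_refl (in_sigma_U_admissible lσ);
  have τr := U_admissible_refl (in_sigma_U_admissible lτ);
  have [σW τW σcW τcW] := subr_compr4 σr τr (σr : reflexive A σ˘) (τr : reflexive A τ˘).
  have [/(subr_trans (@subr_tclos _ _)) H' _] := H Θ σ τ kΘ lσ lτ.
  apply: subr_trans H'; apply: cap_mono; apply: tclos_least; exact: compr_tclos.
have [ΘσW ΘτW ΘσcW ΘτcW] := subr_compr4 (cap_refl Θr σr) (cap_refl Θr τr)
  (cap_refl Θr (σr : reflexive A σ˘)) (cap_refl Θr (τr : reflexive A τ˘)).
apply/tclos_eqr.
  have sub R : R ⊆ (σ ∘ τ ∘ σ˘ ∘ τ˘)⊛ -> Θ ∩ R ⊆ (Θ ∩ (σ ∘ τ ∘ σ˘ ∘ τ˘)⊛)⊛.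
    by move=> RW; apply: subr_trans (@subr_tclos _ _); apply: cap_mono.
  repeat apply: compr_tclos; exact: sub.
have conv_cap R : Θ ∩ R˘ = (Θ ∩ R)˘.
  apply: functional_extensionality => a; apply: functional_extensionality => b.
  by apply: propositional_extensionality; split=> -[/Θs].
set W := (X in X⊛) in ΘσW ΘτW ΘσcW ΘτcW *.
have H' := H Θ _ _ kΘ (in_sigma_union_conv lσ) (in_sigma_union_conv lτ).
have ΘσW' : Θ ∩ (σ ∪ σ˘) ⊆ W⊛ by apply: cap_unionl.
have ΘτW' : Θ ∩ (τ ∪ τ˘) ⊆ W⊛ by apply: cap_unionl.
have swap R : (R ∪ R˘)˘ = R ∪ R˘ by apply: conv_sym => a b [?|?]; [right|left].
rewrite /head_form /= !swap in H'.
apply: subr_trans (subr_trans H' _).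
  apply: cap_mono; apply: tclos_least.
  have σ'Z : σ ∪ σ˘ ⊆ ((σ ∪ σ˘) ∘ (τ ∪ τ˘))⊛.
    apply: subr_trans (@subr_tclos _ _); apply: subr_comprl => a; left; exact: τr.
  have τ'Z : τ ∪ τ˘ ⊆ ((σ ∪ σ˘) ∘ (τ ∪ τ˘))⊛.
    apply: subr_trans (@subr_tclos _ _); apply: subr_comprr => a; left; exact: σr.
  repeat apply: compr_tclos; move=> a b ab;
    by [apply: σ'Z; left|apply: τ'Z; left|apply: σ'Z; right|apply: τ'Z; right].
by apply: tclos_least; repeat apply: compr_tclos.
Qed.

(** In each item the relation intersected with Θ is below ρ⊛ for one of
    ρ = σ, σ ∪ σ˘, σ ∪ τ, and Θ ∩ ρ is below the right-hand side. *)
Lemma head_form_intro i Θ σ τ :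
    (forall ρ, U_admissible ρ -> Θ ∩ ρ⊛ ⊆ (Θ ∩ ρ)⊛) ->
    is_tolerance Θ -> U_admissible σ -> U_admissible τ ->
  head_form i Θ σ τ.
Proof.
move=> cap_tclos [Θr _] Uσ Uτ.
have σr := U_admissible_refl Uσ; have τr := U_admissible_refl Uτ.
have Uσc := U_admissible_conv Uσ.
have [Θσr Θτr] := (cap_refl Θr σr, cap_refl Θr τr).
have [Θσcr Θτcr] := (cap_refl Θr (σr : reflexive A σ˘), cap_refl Θr (τr : reflexive A τ˘)).
have via ρ Y X : U_admissible ρ -> Y ⊆ ρ⊛ -> Θ ∩ ρ ⊆ X⊛ -> Θ ∩ Y ⊆ X⊛.
  move=> Uρ Yρ ρX; apply: subr_trans (cap_mono Yρ) _.
  by apply: subr_trans (cap_tclos _ Uρ) _; apply: tclos_least.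
have inl (R T : relation A) : R ⊆ (R ∪ T)⊛ by move=> a b ab; apply: t_step; left.
have inr (R T : relation A) : T ⊆ (R ∪ T)⊛ by move=> a b ab; apply: t_step; right.
have compl (R T : relation A) : reflexive A T -> R ⊆ (R ∘ T)⊛.
  by move=> Tr; apply: subr_trans (subr_comprl Tr) (@subr_tclos _ _).
have compr (R T : relation A) : reflexive A R -> T ⊆ (R ∘ T)⊛.
  by move=> Rr; apply: subr_trans (subr_comprr Rr) (@subr_tclos _ _).
have σσ : σ ∘ σ ⊆ σ⊛ by apply: compr_tclos; apply: subr_tclos.
have στ : (σ ∘ τ)⊛ ⊆ (σ ∪ τ)⊛ by apply: tclos_least; apply: compr_tclos.
have Uστ := U_admissible_union Uσ Uτ.
case: i; rewrite /head_form /=.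
- apply: (via σ) => //; exact: subr_tclos.
- apply: (via σ) => //; exact: compl.
- apply: (via (σ ∪ σ˘)); first exact: U_admissible_union.
    exact: compr_tclos.
  by apply: cap_unionl; [apply: compl|apply: compr].
- exact: cap_tclos.
- apply: (via (σ ∪ τ)) => //; first exact: subr_trans (@subr_tclos _ _) στ.
  by apply: cap_unionl; [apply: compl|apply: compr].
- apply: (via (σ ∪ τ)) => //.
  by apply: cap_unionl; [apply: compl|apply: compr].
- have [ΘσW ΘτW _ _] := subr_compr4 Θσr Θτr Θσcr Θτcr.
  by apply: (via (σ ∪ τ)) => //; apply: cap_unionl.
Qed.

(** With τ := σ and σ˘ = σ, every right-hand side is below (Θ ∩ σ)⊛. *)
Lemma head_form_elim i Θ σ :
    Relation_Definitions.symmetric A σ -> head_form i Θ σ σ ->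
  Θ ∩ (σ ∘ σ) ⊆ (Θ ∩ σ)⊛.
Proof.
move=> σs; have incl := @subr_tclos A (Θ ∩ σ).
case: i; rewrite /head_form /= ?(conv_sym σs) // => H.
- by apply: subr_trans H _; apply: tclos_least; apply: compr_tclos.
- by apply: subr_trans H _; apply: tclos_least; apply: compr_tclos.
- apply: subr_trans H; apply: cap_mono; apply: compr_tclos; exact: subr_tclos.
- by apply: subr_trans H _; apply: tclos_least; apply: compr_tclos.
- apply: subr_trans (subr_trans (cap_mono (@subr_tclos _ _)) H) _.
  by apply: tclos_least; apply: compr_tclos.
- apply: subr_trans (subr_trans (cap_mono (@subr_tclos _ _)) H) _.
  by apply: tclos_least; repeat apply: compr_tclos.
Qed.

End HeadForms.

Section Transfer.
Variables (S : signature) (V : algebra S -> Prop) (V_variety : is_variety V).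
Variables (F : algebra S) (x : 'I_3 -> F) (F_free : is_free V x).

Lemma jonsson_head_form i k l A : jonsson_terms V -> V A ->
  holds_in k l (head_form i) A.
Proof.
move=> J VA Θ σ τ /in_Theta_tolerance tolΘ lσ lτ.
apply: head_form_intro => //; try exact: (@in_sigma_U_admissible S A l).
by move=> ρ; apply: jonsson_cap_tclos J VA tolΘ.
Qed.

Lemma head_form_jonsson i k l : holds_in k l (head_form i) F -> jonsson_terms V.
Proof.
move=> H; apply: (jonsson_terms_of_chain V_variety F_free).
move=> Θ β γ [CΘ Cβ Cγ Θ02 [β01 γ12]].
have two_βγ := two_congruences Cβ Cγ.
have [[_ _ βs] _] := Cβ; have [[_ _ γs] _] := Cγ.
have lβγ : in_sigma_range l (β ∪ γ).
  by case: (l) => //; apply: union_congruences_U_admissible.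
have kΘ : in_Theta_range k Θ by case: (k) => //; apply: congruence_tolerance.
have βγs : symmetric F (β ∪ γ).
  by move=> u v [uv|uv]; [left; apply: βs|right; apply: γs].
apply: (head_form_elim βγs (H _ _ _ kΘ lβγ lβγ)); split=> //.
by exists (x (inord 1)); split; [left|right].
Qed.

End Transfer.

Theorem corollary2p7 (S : signature) (V : algebra S -> Prop)
    (V_variety : is_variety V)
    (F3 : algebra S) (x : 'I_3 -> F3) (F3_free : is_free V x) (i : item) :
  (forall p : rel_identity, List.In p (forms i) ->
    forall (k : Theta_range) (l : sigma_range),
      (holds_throughout k l p V <-> congruence_distributive V) /\
      (holds_throughout k l p V <-> holds_in k l p F3)) /\
  (forall p q : rel_identity, List.In p (forms i) -> List.In q (forms i) ->
    forall (k : Theta_range) (l : sigma_range) (A : algebra S), V A ->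
      (holds_in k l p A <-> holds_in k l q A)).
Proof.
have VF : V F3 by case: F3_free.
split=> [p ip k l|p q ip iq k l A _]; last first.
  split=> H; first exact/(forms_head _ k l iq)/(forms_head _ k l ip).
  exact/(forms_head _ k l ip)/(forms_head _ k l iq).
have J_V : jonsson_terms V -> holds_throughout k l p V.
  by move=> J A VA; apply/(forms_head _ k l ip); apply: (jonsson_head_form _ J VA).
have F_J : holds_in k l p F3 -> jonsson_terms V.
  by move=> /(forms_head _ k l ip); apply: (head_form_jonsson V_variety F3_free).
split; split.
- by move=> /(_ _ VF) /F_J; apply: jonsson_distributive.
- by move=> D; apply/J_V/(distributive_jonsson V_variety F3_free)/D.
- by apply.
- by move/F_J.
Qed.
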